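(* Let $q\ge 2$ be an integer. (i) If $f(z)=\sum_{m=0}^\infty a_{m,0}^{q-2}R_{m,0}^{q-2}(z)$, where $\sum_{m=0}^\infty a_{m,0}^{q-2}<\infty$ and $a_{m,0}^{q-2}>0$ for all $m$, then $f\in\Psi^+(\Omega_{2q})$ and $\mathcal{D}_zf,\ \mathcal{D}_xf\in\Psi^+(\Omega_{2q+2})$, but $\mathcal{D}_{\overline z}f\notin\Psi^+(\Omega_{2q+2})$. (ii) If $f(z)=\sum_{n=0}^\infty a_{0,n}^{q-2}R_{0,n}^{q-2}(z)$, where $\sum_{n=0}^\infty a_{0,n}^{q-2}<\infty$ and $a_{0,n}^{q-2}>0$ for all $n$, then $f\in\Psi^+(\Omega_{2q})$ and $\mathcal{D}_{\overline z}f,\ \mathcal{D}_xf\in\Psi^+(\Omega_{2q+2})$, but $\mathcal{D}_zf\notin\Psi^+(\Omega_{2q+2})$. (iii) If $f(z)=\sum_{n=0}^\infty a_{0,n}^{q-2}R_{0,n}^{q-2}(z)+\sum_{m=0}^\infty a_{m,0}^{q-2}R_{m,0}^{q-2}(z)$, where $a_{0,n}^{q-2},a_{m,0}^{q-2}\ge 0$ for all $m,n$, and $$a_{0,n}^{q-2}>0\iff n\in 5\mathbb{Z}_++4,$$ $$a_{m,0}^{q-2}>0\iff m\in(5\mathbb{Z}_+\setminus\{0\})\cup(5\mathbb{Z}_++2)\cup(5\mathbb{Z}_++3)\cup(5\mathbb{Z}_++4),$$ then $f\in\Psi^+(\Omega_{2q})$, but $\mathcal{D}_zf,\ \mathcal{D}_{\overline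 z}f,\ \mathcal{D}_xf\notin\Psi^+(\Omega_{2q+2})$.
   Context: $\mathbb{Z}_+=\{0,1,2,\dots\}$, and $5\mathbb{Z}_++j=\{5k+j:k\in\mathbb{Z}_+\}$. $\mathbb{D}=\{z\in\mathbb{C}: |z|\le 1\}$ is the closed unit disc. A function $f\colon\mathbb{D}\to\mathbb{C}$ is called differentiable if, writing $z=x+iy$, it is differentiable as a function of the real variables $x,y$; $\mathcal{D}_x f$, $\mathcal{D}_y f$ denote the partial derivatives, and the Descente operators are $\mathcal{D}_z f=\frac12(\mathcal{D}_x f-i\mathcal{D}_y f)$, $\mathcal{D}_{\overline z} f=\frac12(\mathcal{D}_x f+i\mathcal{D}_y f)$. For an integer $p\ge 2$, $\Omega_{2p}$ is the unit sphere of $\mathbb{C}^p$ and $\langle\cdot,\cdot\rangle$ the usual inner product of $\mathbb{C}^p$. A continuous kernel $K\colon A\times A\to\mathbb{C}$ on a nonempty set $A$ is strictly positive definite if $\sum_{\mu,\nu=1}^{l}c_\mu\overline{c_\nu}K(\xi_\mu,\xi_\nu)> 0$ for all $l\ge1$, all pairwise distinct $\xi_1,\dots,\xi_l\in A$ and all $c_1,\dots,c_l\in\mathbb{C}$ not all zero. $\Psi^+(\Omega_{2p})$ is the class of continuous functions $f\colon\mathbb{D}\to\mathbb{C}$ such that the kernel $K(\xi,\eta)=f(\langle\xi,\eta\rangle)$ on $\Omega_{2p}\times\Omega_{2p}$ is strictly positive definite. For real $\alpha>-1$ and integers $m,n\ge 0$, the disc polynomial is $R_{m,n}^{\alpha}(z)=r^{|m-n|}e^{i(m-n)\theta}R_{\min\{m,n\}}^{(\alpha,|m-n|)}(2r^2-1)$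 for $z=re^{i\theta}\in\mathbb{D}$, where $R_k^{(\alpha,\beta)}$ is the Jacobi polynomial of degree $k$ with parameters $\alpha,\beta$, normalized by $R_k^{(\alpha,\beta)}(1)=1$.
   Formalization: The claims on D_z f, D_z̄ f, D_x f are proved assuming f is differentiable on the closed disc (relative to it); the stated hypotheses do not ensure this: for a_{m,0}=1/(m+1)^2 in (i), f is not differentiable at z=1. The claim f∈Ψ^+(Ω_{2q}) needs no such assumption. *)

(* Defs.v *)
From HB Require Import structures.
From mathcomp Require Import all_boot all_order all_algebra spectral.
From mathcomp Require Import complex.
From mathcomp Require Import all_classical all_reals all_analysis.
Set Implicit Arguments.
Unset Strict Implicit.
Unset Printing Implicit Defensive.
Import Order.TTheory GRing.Theory Num.Theory.
Import numFieldNormedType.Exports.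
Local Open Scope classical_set_scope.
Local Open Scope ring_scope.

(* R[i] as a numClosedFieldType: under this head constant the topology of the
   norm, which every such field carries, is found by inference, while R[i]
   itself has no declared topology. *)
Definition Cx (R : realType) : numClosedFieldType := R[i].

Definition ofR (R : realType) (x : R) : Cx R := real_complex R x.

Definition disc (R : realType) : set (Cx R) := [set z | `|z| <= 1].

(* Rising factorial x (x + 1) ... (x + k - 1). *)
Definition pochhammer (F : fieldType) (x : F) (k : nat) : F :=
  \prod_(i < k) (x + i%:R).

(* The Jacobi polynomial in the form 2F1(-k, k + a + b + 1; a + 1; (1 - X) / 2).
   For a > -1 the denominators do not vanish, and as only the term j = 0
   survives at X = 1, this is the normalization with value 1 at 1. *)
Definition jacobi (F : fieldType) (k : nat) (a b : F) : {poly F} :=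
  \sum_(j < k.+1)
    (pochhammer (- k%:R) j * pochhammer (k%:R + a + b + 1) j
       / (pochhammer (a + 1) j * j`!%:R)) *: (2^-1 *: (1 - 'X)) ^+ j.

(* With z = r e^{i theta}: r is `|z| and e^{i theta} is z / `|z|. At z = 0 the
   angular factor is 0 ^ (m - n), that is 1 if m = n and 0 otherwise, so that
   the product is the right value there too. *)
Definition disc_poly (R : realType) (alpha : R) (m n : nat) (z : Cx R) : Cx R :=
  `|z| ^+ `|m%:Z - n%:Z|%N * (z / `|z|) ^ (m%:Z - n%:Z)
  * (jacobi (minn m n) (ofR alpha) (`|m%:Z - n%:Z|%N)%:R).[2 * `|z| ^+ 2 - 1].

Definition sphere (R : realType) (p : nat) : set 'rV[Cx R]_p :=
  [set xi | dotmx xi xi = 1].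

(* In R[i], 0 < w says that w is real and positive. *)
Definition strictly_pd (R : realType) (T : Type) (A : set T)
    (K : T -> T -> Cx R) : Prop :=
  forall (l : nat) (xi : 'I_l -> T) (c : 'I_l -> Cx R),
    (0 < l)%N -> (forall mu, A (xi mu)) -> injective xi ->
    (exists mu, c mu != 0) ->
    0 < \sum_mu \sum_nu c mu * (c nu)^* * K (xi mu) (xi nu).

(* A function on the closed disc is represented by a total function of which
   only the values on the disc matter. The kernel (xi, eta) |-> f <xi, eta> on
   the sphere is continuous because f is continuous on the disc, so that its
   continuity is not listed separately. *)
Definition PsiPlus (R : realType) (p : nat) (f : Cx R -> Cx R) : Prop :=
  {within @disc R, continuous f} /\
  strictly_pd (@sphere R p) (fun xi eta => f (dotmx xi eta)).

(* f is differentiable at z, relatively to the closed disc, as a function of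
   the real variables x and y, with partial derivatives d.1 and d.2:
   f w = f z + (w - z)_x d.1 + (w - z)_y d.2 + o(|w - z|), w in the disc.
   As the disc is convex with nonempty interior, d is unique, including at the
   boundary points. *)
Definition has_partials (R : realType) (f : Cx R -> Cx R) (z : Cx R)
    (d : Cx R * Cx R) : Prop :=
  (f w - f z - ('Re (w - z) * d.1 + 'Im (w - z) * d.2)) / `|w - z|
    @[w --> within (@disc R) z^'] --> (0 : Cx R).

Definition differentiable_disc (R : realType) (f : Cx R -> Cx R) : Prop :=
  forall z, disc z -> exists d, has_partials f z d.

(* (0, 0) is a junk value where f is not differentiable. *)
Definition partials (R : realType) (f : Cx R -> Cx R) (z : Cx R) :
    Cx R * Cx R :=
  xget (0, 0) [set d | has_partials f z d].

Definition Dx (R : realType) (f : Cx R -> Cx R) (z : Cx R) : Cx R :=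
  (partials f z).1.

Definition Dy (R : realType) (f : Cx R -> Cx R) (z : Cx R) : Cx R :=
  (partials f z).2.

Definition Dz (R : realType) (f : Cx R -> Cx R) (z : Cx R) : Cx R :=
  2^-1 * (Dx f z - 'i * Dy f z).

Definition Dzbar (R : realType) (f : Cx R -> Cx R) (z : Cx R) : Cx R :=
  2^-1 * (Dx f z + 'i * Dy f z).

(* Main.v *)
(* R_{m,0}(z) = z^m and R_{0,n}(z) = (z^* )^n, so every function of the theorem is
   a sum f(z) = sum_m A_m z^m + B_m (z^* )^m with A_m, B_m >= 0.

   Strictness.  Expanding <xi, eta>^m over words of length m shows that its
   quadratic form is a sum of squares; if the form of f vanishes at c, then
   sum_mu c_mu <xi_mu, eta>^m = 0 for all eta and all m with A_m > 0, and
   similarly with conjugates for B.  Taking eta = xi_mu0, the value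
   z_mu = <xi_mu, xi_mu0> is 1 only for mu = mu0, and a polynomial in the
   available powers that vanishes at the other z_mu gives c_mu0 = 0.  In (iii) all
   residues of exponents mod 5 are available, with z^* = z^-1 on the unit circle.

   Derivatives.  Differentiability at the boundary point 1 forces
   sum_m m (A_m + B_m) < oo, whence f is differentiable term by term on the closed
   disc, D_z f has coefficients (m+1) A_{m+1}, D_zbar f has (m+1) B_{m+1}, and
   D_x f is their sum.

   Failure.  If no exponent divisible by 5 occurs, the quadratic form vanishes at
   the five points w^k e, w a primitive fifth root of unity, with equal weights;
   this also covers D_z f = 0 and D_zbar f = 0. *)

Require Import Defs.
From mathcomp Require Import all_boot all_order all_algebra.
From mathcomp Require Import all_classical all_reals all_analysis.
From mathcomp Require Import spectral complex zify ring lra.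
Import Order.TTheory GRing.Theory Num.Theory.
Import numFieldNormedType.Exports.
Local Open Scope classical_set_scope.
Local Open Scope ring_scope.
Set Implicit Arguments.
Unset Strict Implicit.

(** * Separation of points by powers *)

(* Test against a polynomial divisible by 'X that vanishes at the z mu other than 1. *)
Lemma sum_unit_powers (F : fieldType) (l : nat) (b z : 'I_l -> F) :
  (forall j, \sum_mu b mu * z mu ^+ j.+1 = 0) -> \sum_(mu | z mu == 1) b mu = 0.
Proof.
move=> vanish; pose Q : {poly F} := \prod_(mu | z mu != 1) ('X - (z mu)%:P).
have Q1 : Q.[1] != 0.
  rewrite horner_prod prodf_seq_neq0; apply/allP => mu _; apply/implyP => zmu.
  by rewrite hornerXsubC subr_eq0 eq_sym.
have: \sum_mu b mu * (z mu * Q.[z mu]) = 0.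
  rewrite (eq_bigr (fun mu => \sum_(j < size Q) Q`_j * (b mu * z mu ^+ j.+1))) => [|mu _].
    by rewrite exchange_big big1 // => j _; rewrite -mulr_sumr vanish mulr0.
  rewrite horner_coef !mulr_sumr; apply: eq_bigr => j _.
  by rewrite exprS [Q`_j * (b mu * _)]mulrCA; congr (_ * _); rewrite mulrCA.
rewrite (bigID (fun mu => z mu == 1)) /= [X in _ + X]big1 ?addr0; last first.
  move=> mu zmu.
  by rewrite horner_prod (bigD1 mu) //= hornerXsubC subrr mul0r !mulr0.
under eq_bigr => mu /eqP-> do rewrite mul1r.
by rewrite -mulr_suml => /eqP; rewrite mulf_eq0 (negPf Q1) orbF => /eqP.
Qed.

Lemma powers_separate (F : fieldType) (l : nat) (c z : 'I_l -> F) (mu0 : 'I_l) :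
  (forall mu, (z mu == 1) = (mu == mu0)) ->
  (forall m, \sum_mu c mu * z mu ^+ m.+1 = 0) -> c mu0 = 0.
Proof. by move=> z1 /sum_unit_powers; rewrite (eq_bigl _ _ z1) big_pred1_eq. Qed.

(** For each residue r, [sum_unit_powers] applied to the fifth powers restricts the sum to the fifth
    roots of unity. Adding the five residues makes a geometric sum, which kills every such root
    except 1 and leaves 5 times [c mu0]. *)
Lemma powers_mod5_separate (C : numClosedFieldType) (l : nat)
    (c z : 'I_l -> C) (mu0 : 'I_l) :
  (forall mu, (z mu == 1) = (mu == mu0)) ->
  (forall j r, (r < 5)%N -> r != 1%N ->
     \sum_mu c mu * z mu ^+ (5 * j.+1 + r) = 0) ->
  (forall j, \sum_mu c mu * ((z mu)^*) ^+ (5 * j.+1 + 4) = 0) -> c mu0 = 0.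
Proof.
move=> z1 vz vzc.
have S r : (r < 5)%N -> \sum_(mu | z mu ^+ 5 == 1) c mu * z mu ^+ r = 0.
  (* Residue 1 comes from the conjugates with exponent 4: if z^5 = 1, then z lies on the unit
     circle, its conjugate is its inverse, and z^-4 = z. *)
  have [-> _|r1 r5] := eqVneq r 1%N.
    have : \sum_(mu | (z mu)^* ^+ 5 == 1) c mu * (z mu)^* ^+ 4 = 0.
      apply: sum_unit_powers => j; rewrite -[RHS](vzc j); apply: eq_bigr => mu _.
      by rewrite -mulrA -exprM -exprD addnC.
    move=> S4; rewrite -[RHS]S4; apply: eq_big => [mu|mu /eqP z5].
      by rewrite -rmorphXn fmorph_eq1.
    have nz : `|z mu| = 1.
      by apply/eqP; rewrite -(@pexpr_eq1 _ _ 5) // -normrX z5 normr1.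
    have z0 : z mu != 0 by rewrite -normr_eq0 nz oner_eq0.
    congr (_ * _); apply: (mulfI (expf_neq0 4 z0)).
    by rewrite -exprMn -normCK nz !expr1n -exprD.
  apply: sum_unit_powers => j; rewrite -[RHS](vz j r r5 r1); apply: eq_bigr => mu _.
  by rewrite -mulrA -exprM -exprD addnC.
have : \sum_(r < 5) \sum_(mu | z mu ^+ 5 == 1) c mu * z mu ^+ r = 0.
  by apply: big1 => r _; apply: S.
rewrite exchange_big (bigD1 mu0) /=; last first.
  by have /eqP-> : z mu0 == 1; rewrite ?z1 // expr1n.
rewrite [X in _ + X]big1 => [|mu /andP[/eqP z5 mu0P]]; last first.
  rewrite -mulr_sumr; apply/eqP; rewrite mulf_eq0; apply/orP; right.
  have : z mu - 1 != 0 by rewrite subr_eq0 z1.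
  by move/mulfI => inj; apply/eqP/inj; rewrite mulr0 -subrX1 z5 subrr.
have /eqP-> : z mu0 == 1 by rewrite z1.
under eq_bigr => ? _ do rewrite expr1n mulr1.
by rewrite addr0 sumr_const card_ord => /eqP; rewrite mulrn_eq0 => /eqP.
Qed.

(** * Powers of the inner product *)

(** The right-hand side is the inner product of the m-th tensor powers of [u] and [v], whose
    coordinates are indexed by words of length m. *)
Lemma dotmx_exp (C : numClosedFieldType) (p m : nat) (u v : 'rV[C]_p) :
  dotmx u v ^+ m
  = \sum_(w : {ffun 'I_m -> 'I_p}) (\prod_i u 0 (w i)) * (\prod_i v 0 (w i))^*.
Proof.
rewrite dotmxE !mxE -[in LHS](card_ord m) -prodr_const bigA_distr_bigA /=.
apply: eq_bigr => w _; rewrite rmorph_prod -big_split /=.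
by apply: eq_bigr => i _; rewrite !mxE.
Qed.

Lemma power_kernelE (C : numClosedFieldType) (l p m : nat)
    (xi : 'I_l -> 'rV[C]_p) (c : 'I_l -> C) :
  \sum_mu \sum_nu c mu * (c nu)^* * dotmx (xi mu) (xi nu) ^+ m
  = \sum_(w : {ffun 'I_m -> 'I_p}) `|\sum_mu c mu * \prod_i xi mu 0 (w i)| ^+ 2.
Proof.
under [RHS]eq_bigr => w _.
  rewrite normCK rmorph_sum mulr_suml.
  under eq_bigr => mu _ do rewrite mulr_sumr.
  over.
rewrite [RHS]exchange_big; apply: eq_bigr => mu _ /=.
rewrite [RHS]exchange_big; apply: eq_bigr => nu _ /=.
by rewrite dotmx_exp mulr_sumr; apply: eq_bigr => w _; rewrite rmorphM mulrACA.
Qed.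

Lemma power_kernel_ge0 (C : numClosedFieldType) (l p m : nat)
    (xi : 'I_l -> 'rV[C]_p) (c : 'I_l -> C) :
  0 <= \sum_mu \sum_nu c mu * (c nu)^* * dotmx (xi mu) (xi nu) ^+ m.
Proof. by rewrite power_kernelE sumr_ge0 // => w _; rewrite exprn_ge0. Qed.

(** A vanishing sum of squares makes each word sum vanish, and by [dotmx_exp] the conclusion is a
    linear combination of these word sums. *)
Lemma power_kernel_eq0 (C : numClosedFieldType) (l p m : nat)
    (xi : 'I_l -> 'rV[C]_p) (c : 'I_l -> C) (eta : 'rV[C]_p) :
  \sum_mu \sum_nu c mu * (c nu)^* * dotmx (xi mu) (xi nu) ^+ m = 0 ->
  \sum_mu c mu * dotmx (xi mu) eta ^+ m = 0.
Proof.
rewrite power_kernelE => /eqP; rewrite psumr_eq0 => [/allP K0|w _]; last by rewrite exprn_ge0.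
under eq_bigr => ? _ do rewrite dotmx_exp mulr_sumr.
rewrite exchange_big big1 // => w _; under eq_bigr => ? _ do rewrite mulrA.
have := K0 w (mem_index_enum _); rewrite /= expf_eq0 normr_eq0 => /eqP S0.
by rewrite -mulr_suml S0 mul0r.
Qed.

(** This turns conjugate powers of the kernel into ordinary powers at the conjugated vectors. *)
Lemma dotmx_conj (C : numClosedFieldType) (p : nat) (u v : 'rV[C]_p) :
  dotmx (map_mx Num.conj u) (map_mx Num.conj v) = (dotmx u v)^*.
Proof. by rewrite !dotmxE !mxE rmorph_sum; apply: eq_bigr => i _; rewrite !mxE rmorphM. Qed.

Lemma norm_dotmx_le1 (C : numClosedFieldType) (p : nat) (u v : 'rV[C]_p) :
  dotmx u u = 1 -> dotmx v v = 1 -> `|dotmx u v| <= 1.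
Proof.
move=> u1 v1; have : `|dotmx u v| ^+ 2 <= dotmx u u * dotmx v v.
  by case: (CauchySchwarz (@dotmx C p) u v).
by rewrite u1 v1 mulr1 expr_le1.
Qed.

(** For unit vectors the squared norm of u - v is 2 - 2 Re <u, v>, which is 0 when <u, v> = 1. *)
Lemma dotmx_eq1 (C : numClosedFieldType) (p : nat) (u v : 'rV[C]_p) :
  dotmx u u = 1 -> dotmx v v = 1 -> (dotmx u v == 1) = (u == v).
Proof.
move=> u1 v1; apply/eqP/eqP => [uv1|<-//]; apply/eqP; rewrite -subr_eq0.
have uv0 : dotmx (u - v) (u - v) = 0.
  transitivity (dotmx u u + dotmx v v - (dotmx u v + (dotmx u v)^*)).
    exact: (dnormB (@dotmx C p)).
  by rewrite u1 v1 uv1 rmorph1 subrr.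
by have <- := dnorm_eq0 (@dotmx C p) (u - v); apply/eqP.
Qed.

(** * Limits of nonnegative terms in a partially ordered field *)

(** The order may be partial, as on [Cx R]. Nonnegativity is therefore read as the equation x =
    [|x|], which passes to the limit by continuity of the norm. *)
Lemma limit_ge0 (K : numFieldType) (T : Type) (F : set_system T)
    {FF : ProperFilter F} (u : T -> K) (l : K) :
  (\forall x \near F, 0 <= u x) -> u @ F --> l -> 0 <= l.
Proof.
move=> u0 ul; suff -> : l = `|l| by exact: normr_ge0.
apply: (cvg_unique (@norm_hausdorff _ _) ul).
apply: cvg_trans (cvg_norm ul); apply: near_eq_cvg.
by apply: filterS u0 => x /ger0_norm.
Qed.

Lemma limit_norm_le (K : numFieldType) (T : Type) (F : set_system T)
    {FF : ProperFilter F} (u : T -> K) (l b : K) :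
  (\forall x \near F, `|u x| <= b) -> u @ F --> l -> `|l| <= b.
Proof.
move=> ub ul; rewrite -subr_ge0; apply: (@limit_ge0 _ _ F _ (fun x => b - `|u x|)).
  by apply: filterS ub => x; rewrite subr_ge0.
by apply: cvgB; [exact: cvg_cst|exact: cvg_norm].
Qed.

Lemma series_le_limit (K : numFieldType) (u : nat -> K) (L : K) (n : nat) :
  (forall m, 0 <= u m) -> series u @ \oo --> L -> series u n <= L.
Proof.
move=> u0 uL; rewrite -subr_ge0.
apply: (@limit_ge0 _ _ \oo _ (fun k => series u k - series u n)).
  by exists n => // k /= nk; rewrite sub_series_geq // sumr_ge0.
by apply: cvgB => //; exact: cvg_cst.
Qed.

Lemma term_le_limit (K : numFieldType) (u : nat -> K) (L : K) (n : nat) :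
  (forall m, 0 <= u m) -> series u @ \oo --> L -> u n <= L.
Proof.
move=> u0 /series_le_limit; move/(_ n.+1 u0); apply: le_trans.
by rewrite seriesSr lerDr /series /= sumr_ge0.
Qed.

(** * Series of complex numbers *)

Section ComplexSeries.
Variable R : realType.
Implicit Types (x y : R) (A B M : nat -> R) (u : nat -> Cx R) (f : Cx R -> Cx R).

Lemma ofRD x y : ofR (x + y) = ofR x + ofR y. Proof. exact: rmorphD. Qed.
Lemma ofRB x y : ofR (x - y) = ofR x - ofR y. Proof. exact: rmorphB. Qed.
Lemma ofRM x y : ofR (x * y) = ofR x * ofR y. Proof. exact: rmorphM. Qed.
Lemma ofRX x n : ofR (x ^+ n) = ofR x ^+ n. Proof. exact: rmorphXn. Qed.
Lemma ofR_nat n : ofR (n%:R : R) = n%:R. Proof. exact: rmorph_nat. Qed.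
Lemma le_ofR x y : (ofR x <= ofR y) = (x <= y). Proof. exact: lecR. Qed.
Lemma lt_ofR x y : (ofR x < ofR y) = (x < y). Proof. exact: ltcR. Qed.
Lemma ofR_ge0 x : (0 <= ofR x) = (0 <= x). Proof. exact: ler0c. Qed.
Lemma ofR_gt0 x : (0 < ofR x) = (0 < x). Proof. exact: (ltcR 0). Qed.
Lemma ofR_inj : injective (@ofR R). Proof. exact: complexI. Qed.

Lemma ofR_eq0 x : (ofR x == 0) = (x == 0).
Proof. exact: (inj_eq ofR_inj x 0). Qed.

Lemma ofR_sum (I : Type) (s : seq I) (P : pred I) (F : I -> R) :
  ofR (\sum_(i <- s | P i) F i) = \sum_(i <- s | P i) ofR (F i).
Proof. exact: rmorph_sum. Qed.

Lemma norm_ofR x : `|ofR x| = ofR `|x|.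
Proof.
have [x0|x0] := leP 0 x; first by rewrite !ger0_norm ?ofR_ge0.
rewrite (ltr0_norm x0) ltr0_norm; first exact/esym/rmorphN.
by rewrite -(lt_ofR x 0) in x0.
Qed.

Lemma realC (z : Cx R) : z \is Num.real -> exists x, z = ofR x.
Proof. by move=> /RRe_real zE; exists (complex.Re z). Qed.

Lemma conj_ofR x : (ofR x)^* = ofR x.
Proof. by apply/CrealP/complex_realP; exists x. Qed.

Lemma cvg_ofR (T : Type) (F : set_system T) {FF : Filter F} (g : T -> R) x :
  g @ F --> x -> (fun t => ofR (g t)) @ F --> ofR x.
Proof.
move=> gx; apply/cvgrPdist_lt => e e0.
have [r er] := realC (gtr0_real e0); rewrite er ofR_gt0 in e0.
move/cvgrPdist_lt: gx => /(_ r e0); apply: filterS => t.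
by rewrite er -ofRB norm_ofR lt_ofR.
Qed.

Lemma series_ofR A n : ofR (series A n) = series (fun m => ofR (A m)) n.
Proof. exact: ofR_sum. Qed.

(** Completeness is borrowed from [R]: the real and imaginary parts are real series dominated by
    [M]. *)
Lemma normal_series_cvg u M : (forall m, `|u m| <= ofR (M m)) ->
  cvg (series M @ \oo) -> exists L : Cx R, series u @ \oo --> L.
Proof.
move=> uM cM.
have part (g : Cx R -> Cx R) : (forall z, g z \is Num.real) ->
    (forall z, `|g z| <= `|z|) -> exists L : Cx R, series (g \o u) @ \oo --> L.
  move=> greal gle; have /choice[x gx] m := realC (greal (u m)).
  have cx : cvg (series x @ \oo).
    apply: normed_cvg; apply: series_le_cvg cM => m //=.
      by rewrite -ofR_ge0 (le_trans _ (uM m)).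
    by rewrite -le_ofR -norm_ofR -gx (le_trans (gle _)).
  exists (ofR (lim (series x @ \oo))).
  have -> : series (g \o u) = (fun n => ofR (series x n)).
    by apply/funext => n; rewrite series_ofR; apply: eq_bigr => m _ /=.
  exact: cvg_ofR.
have [//|a ha] := part (fun z => 'Re z) (fun z => Creal_Re z).
  by move=> z; case: (leif_normC_Re_Creal z).
have [//|b hb] := part (fun z => 'Im z) (fun z => Creal_Im z).
  (* Since Im z = - Re (i z), the bound for real parts applies to i z, which has the norm of z. *)
  move=> z; rewrite -normrN -ReMil -[leRHS]mul1r -(@normCi (Cx R)) -normrM.
  by case: (leif_normC_Re_Creal ('i * z)).
exists (a + 'i * b).
have -> : series u = (fun n => series ((fun z => 'Re z) \o u) n
    + 'i * series ((fun z => 'Im z) \o u) n).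
  apply/funext => n; rewrite /series /= mulr_sumr -big_split /=.
  by apply: eq_bigr => m _; rewrite -Crect.
exact: (cvgD ha (cvgM (cvg_cst 'i) hb)).
Qed.

End ComplexSeries.

(** * Normally convergent series of functions, and disc polynomials with a zero index *)

Section HarmonicSums.
Variable R : realType.
Implicit Types (x y : R) (A B M : nat -> R) (f F : Cx R -> Cx R).

Lemma cvg_partial_sum (T : Type) (G : set_system T) {FG : Filter G}
    (phi : nat -> T -> Cx R) (l : nat -> Cx R) n :
  (forall m, phi m w @[w --> G] --> l m) ->
  series (phi^~ w) n @[w --> G] --> series l n.
Proof.
move=> phil; elim: n => [|n IHn].
  have series0 (u : nat -> Cx R) : series u 0%N = 0 by rewrite /series /= big_geq.
  rewrite series0 (funext (fun w => series0 (phi^~ w))).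
  exact: cvg_cst.
rewrite seriesSr.
have -> : (fun w => series (phi^~ w) n.+1) = (fun w => series (phi^~ w) n + phi n w).
  by apply/funext => w; rewrite seriesSr.
exact: (cvgD IHn (phil n)).
Qed.

Lemma series_tail_le (u : nat -> Cx R) M (L : Cx R) n :
  (forall m, `|u m| <= ofR (M m)) -> cvg (series M @ \oo) ->
  series u @ \oo --> L ->
  `|L - series u n| <= ofR (lim (series M @ \oo) - series M n).
Proof.
move=> uM cM uL.
have M0 m : 0 <= M m by rewrite -ofR_ge0 (le_trans _ (uM m)).
apply: (@limit_norm_le _ _ \oo _ (fun k => series u k - series u n)); last first.
  exact: (cvgB uL (cvg_cst _)).
exists n => // k /= nk; rewrite sub_series_geq //.
apply: le_trans (ler_norm_sum _ _ _) _.
apply: le_trans (ler_sum _ (fun m _ => uM m)) _.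
rewrite -ofR_sum -sub_series_geq // le_ofR lerD2r.
exact: series_le_limit.
Qed.

(** Weierstrass test: some partial sum is within r / 3 of [F] on all of [D], and being continuous at
    z relatively to [D] it moves by less than r / 3 near z. *)
Lemma dominated_series_cvg (D : set (Cx R)) (phi : nat -> Cx R -> Cx R) M F z :
  (forall m w, D w -> `|phi m w| <= ofR (M m)) -> cvg (series M @ \oo) ->
  (forall w, D w -> series (phi^~ w) @ \oo --> F w) -> D z ->
  (forall m, phi m w @[w --> within D (nbhs z)] --> phi m z) ->
  F w @[w --> within D (nbhs z)] --> F z.
Proof.
move=> phiM cM phiF Dz phic; apply/cvgrPdist_lt => e e0.
have [r er] := realC (gtr0_real e0); rewrite er ofR_gt0 in e0.
have r3 : 0 < r / 3 by rewrite divr_gt0.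
have /cvgrPdist_lt/(_ _ r3)[n _ /(_ n (leqnn n)) tail] := cM.
have near_n w : D w -> `|F w - series (phi^~ w) n| <= ofR (r / 3).
  move=> Dw; apply: le_trans (series_tail_le n _ cM (phiF _ Dw)) _.
    by move=> m; exact: phiM.
  by rewrite le_ofR; exact/ltW/(le_lt_trans (ler_norm _))/tail.
have := @cvg_partial_sum _ _ (within_filter D (nbhs_filter z)) _ _ n phic.
move=> /cvgrPdist_lt /(_ (ofR (r / 3))).
rewrite ofR_gt0 => /(_ r3).
apply: filterS2 (withinT D (@nbhs_filter _ z)) => w Dw Sn.
rewrite (_ : F z - F w = (F z - series (phi^~ z) n)
   + (series (phi^~ z) n - series (phi^~ w) n) + (series (phi^~ w) n - F w)); last first.
  by rewrite !addrA !subrK.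
have r_split : ofR r = ofR (r / 3) + ofR (r / 3) + ofR (r / 3).
  by rewrite -!ofRD; congr ofR; lra.
rewrite er r_split; apply: le_lt_trans (ler_normD _ _) _.
apply: ltr_leD; last by rewrite distrC near_n.
apply: le_lt_trans (ler_normD _ _) _.
by apply: ler_ltD => //; exact: near_n.
Qed.

(** The Jacobi factor has degree 0 and equals 1. The point 0 is treated apart, because there z /
    [|z|] takes the default value 0. *)
Lemma disc_poly_m0 (alpha : R) (m : nat) (z : Cx R) :
  disc_poly alpha m 0 z = z ^+ m.
Proof.
rewrite /disc_poly minn0 /jacobi big_ord1 /pochhammer !big_ord0 expr0.
rewrite fact0 !(mulr1, invr1) scale1r hornerC mulr1 subr0 absz_nat -exprnP.
have [->|z0] := eqVneq z 0.
  by case: m => [|m]; rewrite ?expr0 ?mulr1 // normr0 !expr0n mul0r.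
by rewrite -exprMn mulrCA mulfV ?normr_eq0 // mulr1.
Qed.

(** The angular exponent is now negative: r times the inverse of z / r is r^2 / z, the conjugate of
    z. *)
Lemma disc_poly_0n (alpha : R) (n : nat) (z : Cx R) :
  disc_poly alpha 0 n z = z^* ^+ n.
Proof.
rewrite /disc_poly min0n /jacobi big_ord1 /pochhammer !big_ord0 expr0.
rewrite fact0 !(mulr1, invr1) scale1r hornerC mulr1 sub0r abszN absz_nat.
rewrite -invr_expz -exprnP.
have [->|z0] := eqVneq z 0.
  by case: n => [|n]; rewrite ?expr0 ?invr1 ?mulr1 // conjC0 normr0 !expr0n mul0r.
have nz0 : `|z| != 0 by rewrite normr_eq0.
rewrite -exprVn -exprMn invf_div mulrA -expr2 normCK.
by rewrite [z * _]mulrC mulfK.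
Qed.

(** A single series carries both kinds of powers. Taking [B] or [A] zero gives cases (i) and (ii),
    and also D_z f and D_zbar f. *)
Definition harmonic_sum A B f := forall z : Cx R, disc z ->
  series (fun m => ofR (A m) * z ^+ m + ofR (B m) * z^* ^+ m) @ \oo --> f z.

End HarmonicSums.

(** * Strict positive definiteness *)

Section HarmonicPsi.
Variable R : realType.
Implicit Types (x y : R) (A B M : nat -> R) (f F : Cx R -> Cx R) (z : Cx R).

Lemma cvg_conj (T : Type) (G : set_system T) {FG : Filter G} (g : T -> Cx R) z :
  g @ G --> z -> (fun t => (g t)^*) @ G --> z^*.
Proof.
move=> /cvgrPdist_lt gz; apply/cvgrPdist_lt => e /gz.
by apply: filterS => t; rewrite -rmorphB norm_conjC.
Qed.

Lemma cvg_pow (T : Type) (G : set_system T) {FG : Filter G} (g : T -> Cx R) z n :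
  g @ G --> z -> (fun t => g t ^+ n) @ G --> z ^+ n.
Proof.
move=> gz; elim: n => [|n IHn].
  rewrite expr0 (funext (fun t => expr0 (g t))); exact: cvg_cst.
rewrite exprS (funext (fun t => exprS (g t) n)).
exact: (cvgM gz IHn).
Qed.

Lemma disc1 : @disc R 1. Proof. by rewrite /disc /= normr1. Qed.

Lemma norm_harmonic_term_le A B z m : 0 <= A m -> 0 <= B m -> disc z ->
  `|ofR (A m) * z ^+ m + ofR (B m) * z^* ^+ m| <= ofR (A m + B m).
Proof.
move=> A0 B0 z1; apply: le_trans (ler_normD _ _) _; rewrite ofRD.
have zm : `|z| ^+ m <= 1 by rewrite exprn_ile1.
apply: lerD.
  by rewrite normrM norm_ofR (ger0_norm A0) normrX ler_piMr ?ofR_ge0.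
by rewrite normrM norm_ofR (ger0_norm B0) normrX norm_conjC ler_piMr ?ofR_ge0.
Qed.

(** At z = 1 the terms are A_m + B_m, so the partial sums are nondecreasing and bounded by f 1. *)
Lemma harmonic_summable A B f : (forall m, 0 <= A m) -> (forall m, 0 <= B m) ->
  harmonic_sum A B f -> cvg (series (fun m => A m + B m) @ \oo).
Proof.
move=> A0 B0 /(_ 1 disc1); rewrite conjC1.
have -> : (fun m => ofR (A m) * 1 ^+ m + ofR (B m) * 1 ^+ m)
    = (fun m => ofR (A m + B m)).
  by apply/funext => m; rewrite expr1n !mulr1 ofRD.
set u := (fun m => ofR (A m + B m)) => uf1.
have u0 m : 0 <= u m by rewrite ofR_ge0 addr_ge0.
have ule n := series_le_limit n u0 uf1.
(* Being comparable to 0 in the complex order forces f 1 to be real. *)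
have [r fr] : exists r, f 1 = ofR r.
  by apply: realC; apply: ger0_real; apply: le_trans (ule 0%N); rewrite /series /= sumr_ge0.
apply: nondecreasing_is_cvgn.
  by apply: nondecreasing_series => m _ _; rewrite addr_ge0.
by exists r => _ [n _ <-]; rewrite -le_ofR -fr series_ofR; exact: ule.
Qed.

Lemma harmonic_continuous A B f : (forall m, 0 <= A m) -> (forall m, 0 <= B m) ->
  harmonic_sum A B f -> {within @disc R, continuous f}.
Proof.
move=> A0 B0 hf; apply/subspace_continuousP => z z1.
apply: (dominated_series_cvg (M := fun m => A m + B m)
    (phi := fun m w => ofR (A m) * w ^+ m + ofR (B m) * w^* ^+ m)) => //.
- by move=> m w; exact: norm_harmonic_term_le.
- exact: harmonic_summable hf.
move=> m; have FD := within_filter (@disc R) (nbhs_filter z).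
have idw : w @[w --> within (@disc R) (nbhs z)] --> z by exact: cvg_within.
exact: (cvgD (cvgM (cvg_cst (ofR (A m))) (cvg_pow (n := m) idw))
             (cvgM (cvg_cst (ofR (B m))) (cvg_pow (n := m) (cvg_conj idw)))).
Qed.

Lemma cvg_finite_sum (I T : Type) (G : set_system T) {FG : Filter G} (s : seq I)
    (g : I -> T -> Cx R) (a : I -> Cx R) :
  (forall i, g i @ G --> a i) ->
  (fun t => \sum_(i <- s) g i t) @ G --> \sum_(i <- s) a i.
Proof.
move=> ga; elim: s => [|i s IHs].
  rewrite big_nil (funext (fun t => big_nil _ _ _ (fun i => g i t))).
  exact: cvg_cst.
rewrite big_cons (funext (fun t => big_cons _ _ i s _ (fun i => g i t))) /=.
exact: (cvgD (ga i) IHs).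
Qed.

(** Finite sums commute with the limit, and Cauchy-Schwarz keeps every inner product in the disc,
    where the series of f converges. *)
Lemma cvg_quadratic_form A B f p l (xi : 'I_l -> 'rV[Cx R]_p) (c : 'I_l -> Cx R) :
  harmonic_sum A B f -> (forall mu, sphere (xi mu)) ->
  series (fun m =>
    ofR (A m) * (\sum_mu \sum_nu c mu * (c nu)^* * dotmx (xi mu) (xi nu) ^+ m)
    + ofR (B m) * (\sum_mu \sum_nu c mu * (c nu)^* * (dotmx (xi mu) (xi nu))^* ^+ m))
  @ \oo --> \sum_mu \sum_nu c mu * (c nu)^* * f (dotmx (xi mu) (xi nu)).
Proof.
move=> hf sphxi.
pose u (mu nu : 'I_l) m := ofR (A m) * dotmx (xi mu) (xi nu) ^+ m
  + ofR (B m) * (dotmx (xi mu) (xi nu))^* ^+ m.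
rewrite [X in X @ \oo --> _](_ : _ =
    (fun n => \sum_mu \sum_nu c mu * (c nu)^* * series (u mu nu) n)).
  apply: cvg_finite_sum => mu; apply: cvg_finite_sum => nu.
  apply: (cvgM (cvg_cst (c mu * (c nu)^*))).
  by apply: hf; rewrite /disc /=; apply: norm_dotmx_le1; exact: sphxi.
apply/funext => n; rewrite /series /=.
under [RHS]eq_bigr => mu _.
  under eq_bigr => nu _ do rewrite mulr_sumr.
  rewrite exchange_big. over.
rewrite /= exchange_big; apply: eq_bigr => m _ /=.
rewrite !mulr_sumr -big_split; apply: eq_bigr => mu _ /=.
rewrite !mulr_sumr -big_split; apply: eq_bigr => nu _ /=.
by rewrite /u mulrDr; congr (_ + _); rewrite mulrCA.
Qed.

(* Only the value 1 has to be recognised among the z_mu: strictness is tested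
   with z_mu = <xi_mu, xi_mu0>, which is 1 exactly when mu = mu0. *)
Definition separating A B := forall l (c z : 'I_l -> Cx R) (mu0 : 'I_l),
  (forall mu, (z mu == 1) = (mu == mu0)) ->
  (forall m, 0 < A m -> \sum_mu c mu * z mu ^+ m = 0) ->
  (forall m, 0 < B m -> \sum_mu c mu * (z mu)^* ^+ m = 0) -> c mu0 = 0.

Lemma harmonic_PsiPlus A B f p : (forall m, 0 <= A m) -> (forall m, 0 <= B m) ->
  separating A B -> harmonic_sum A B f -> PsiPlus p f.
Proof.
move=> A0 B0 sepAB hf; split; first exact: harmonic_continuous hf.
move=> l xi c _ sphxi xi_inj [mu0 cmu0].
set T := \sum_mu _.
pose Q m := \sum_mu \sum_nu c mu * (c nu)^* * dotmx (xi mu) (xi nu) ^+ m.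
pose Q' m := \sum_mu \sum_nu c mu * (c nu)^* * (dotmx (xi mu) (xi nu))^* ^+ m.
have cvgT : series (fun m => ofR (A m) * Q m + ofR (B m) * Q' m) @ \oo --> T.
  exact: cvg_quadratic_form hf sphxi.
have Q'E m : Q' m = \sum_mu \sum_nu c mu * (c nu)^*
    * dotmx (map_mx Num.conj (xi mu)) (map_mx Num.conj (xi nu)) ^+ m.
  by apply: eq_bigr => mu _; apply: eq_bigr => nu _; rewrite dotmx_conj.
have AQ0 m : 0 <= ofR (A m) * Q m.
  by rewrite mulr_ge0 ?ofR_ge0 // power_kernel_ge0.
have BQ0 m : 0 <= ofR (B m) * Q' m.
  by rewrite mulr_ge0 ?ofR_ge0 // Q'E power_kernel_ge0.
have AB0 m : 0 <= ofR (A m) * Q m + ofR (B m) * Q' m by rewrite addr_ge0.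
have Tle m := term_le_limit m AB0 cvgT.
have T0 : 0 <= T by apply: le_trans (Tle 0%N).
rewrite lt_def T0 andbT; apply: contraNneq cmu0 => T_eq0; apply/eqP.
(* All terms are nonnegative and none exceeds the limit [T], so [T = 0] annihilates each of them. *)
have AB_eq0 m : ofR (A m) * Q m = 0 /\ ofR (B m) * Q' m = 0.
  have /eqP : ofR (A m) * Q m + ofR (B m) * Q' m = 0.
    by apply/eqP; rewrite eq_le AB0 -T_eq0 Tle.
  by rewrite paddr_eq0 // => /andP[/eqP-> /eqP->].
apply: (sepAB l c (fun mu => dotmx (xi mu) (xi mu0))) => [mu|m Am|m Bm].
- by rewrite dotmx_eq1 ?(inj_eq xi_inj) //; exact: sphxi.
- apply: power_kernel_eq0; apply/eqP; have [/eqP] := AB_eq0 m.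
  by rewrite mulf_eq0 ofR_eq0 gt_eqF.
have : \sum_mu c mu * dotmx (map_mx Num.conj (xi mu)) (map_mx Num.conj (xi mu0)) ^+ m = 0.
  apply: power_kernel_eq0; apply/eqP; rewrite -Q'E; have [_ /eqP] := AB_eq0 m.
  by rewrite mulf_eq0 ofR_eq0 gt_eqF.
by under eq_bigr => mu _ do rewrite dotmx_conj.
Qed.

Lemma separating_all A B : (forall m, 0 < A m) -> separating A B.
Proof. by move=> A0 l c z mu0 z1 vA _; apply: (powers_separate z1) => m; exact: vA. Qed.

Lemma separatingC A B : separating A B -> separating B A.
Proof.
move=> sepAB l c z mu0 z1 vB vA.
apply: (sepAB l c (fun mu => (z mu)^*)) => // [mu|m Bm]; first by rewrite fmorph_eq1.
by under eq_bigr => mu _ do rewrite conjCK; exact: vB.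
Qed.

(** The shift [j.+1] avoids the exponent 0, absent in case (iii). Residue 1, not asked of [A], is
    supplied by the conjugate powers of residue 4. *)
Lemma separating_mod5 A B :
  (forall j r, (r < 5)%N -> r != 1%N -> 0 < A (5 * j.+1 + r)%N) ->
  (forall j, 0 < B (5 * j + 4)%N) -> separating A B.
Proof.
move=> Apos Bpos l c z mu0 z1 vA vB.
by apply: (powers_mod5_separate z1) => [j r r5 r1|j]; [apply: vA; exact: Apos|exact: vB].
Qed.

(** A root of 1 + X + ... + X^4 has order dividing the prime 5, and is not 1 because the value at 1
    is 5. *)
Lemma ex_fifth_root (C : numClosedFieldType) : exists w : C, 5.-primitive_root w.
Proof.
pose P : {poly C} := \poly_(i < 5) 1.
have sP : size P = 5 by rewrite size_poly_eq // oner_eq0.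
have [w] : exists w, root P w by apply/closed_rootP; rewrite sP.
rewrite /root horner_poly => /eqP w0; exists w.
have w5 : w ^+ 5 = 1.
  apply/eqP; rewrite -subr_eq0 subrX1.
  by under eq_bigr do rewrite -[_ ^+ _]mul1r; rewrite w0 mulr0.
have [m mw] := prim_order_exists (isT : (0 < 5)%N) w5.
move=> /(prime_nt_dvdP (isT : prime 5)) h.
have m1 : m != 1%N.
  apply/eqP => m1; move: mw; rewrite m1 => /prim_expr_order; rewrite expr1 => w1.
  move/eqP: w0; rewrite w1 => /eqP.
  under eq_bigr do rewrite expr1n mulr1.
  by rewrite sumr_const card_ord => /eqP; rewrite mulrn_eq0 oner_eq0.
by rewrite -(h m1).
Qed.

Lemma sum_prim_root (F : fieldType) (n e : nat) (w : F) :
  n.-primitive_root w -> ~~ (n %| e)%N -> \sum_(k < n) w ^+ (k * e) = 0.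
Proof.
move=> wn ne; have : w ^+ e - 1 != 0 by rewrite subr_eq0 -(prim_order_dvd wn).
move/mulfI; apply; rewrite mulr0.
under eq_bigr => k _ do rewrite mulnC exprM.
by rewrite -subrX1 -exprM mulnC exprM (prim_expr_order wn) expr1n subrr.
Qed.

(* The fifth roots of unity times a unit vector, with equal coefficients, kill
   every power whose exponent is not a multiple of 5. *)
Lemma harmonic_not_PsiPlus A B f p : harmonic_sum A B f ->
  (forall m, (5 %| m)%N -> A m = 0 /\ B m = 0) -> ~ PsiPlus p.+1 f.
Proof.
move=> hf AB5 [_ spd]; have [w w5] := ex_fifth_root (Cx R).
have nw : `|w| = 1.
  by apply/eqP; rewrite -(@pexpr_eq1 _ _ 5) // -normrX (prim_expr_order w5) normr1.
pose e : 'rV[Cx R]_p.+1 := delta_mx 0 0.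
pose xi (k : 'I_5) : 'rV[Cx R]_p.+1 := w ^+ k *: e.
have dxi j k : dotmx (xi j) (xi k) = w ^+ j * (w ^+ k)^*.
  rewrite dotmxE !mxE big_ord_recl big1 => [|i _]; rewrite !mxE /= ?mulr1 ?addr0 //.
  by rewrite !mulr0 mul0r.
have sphxi k : sphere (xi k).
  by rewrite /sphere /= dxi -normCK normrX nw !expr1n.
have xi_inj : injective xi.
  move=> j k /(congr1 (fun v : 'rV_p.+1 => v 0 0)); rewrite !mxE /= !mulr1 => /eqP.
  rewrite (eq_prim_root_expr w5) !modn_small // => /eqP jk; exact: val_inj.
have := spd 5 xi (fun=> 1) isT sphxi xi_inj (ex_intro _ ord0 (oner_neq0 _)).
have := cvg_quadratic_form (c := fun=> 1) hf sphxi.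
have sumw m : ~~ (5 %| m)%N -> \sum_(k < 5) (w ^+ k) ^+ m = 0.
  by under eq_bigr do rewrite -exprM; exact: sum_prim_root.
have sumw0 (g h : 'I_5 -> Cx R) : \sum_k g k = 0 -> \sum_j \sum_k g j * h k = 0.
  move=> g0; under eq_bigr do rewrite -mulr_sumr.
  by rewrite -mulr_suml g0 mul0r.
rewrite (_ : series _ = fun=> 0) => [T0|].
  by rewrite (cvg_unique (@norm_hausdorff _ _) T0 (cvg_cst 0)) ltxx.
apply/funext => n; rewrite /series /=; apply: big1 => m _.
(* Multiples of 5 have zero coefficients; for other exponents both double sums factor through a
   vanishing sum of powers of [w]. *)
have [/AB5[-> ->]|m5] := boolP (5 %| m)%N; first by rewrite !mul0r addr0.
rewrite [X in _ * X + _](_ : _ = 0) ?[X in _ + _ * X](_ : _ = 0) ?mulr0 ?addr0 //.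
  transitivity (\sum_(j < 5) \sum_(k < 5) (w ^+ j)^* ^+ m * (w ^+ k) ^+ m).
    apply: eq_bigr => j _; apply: eq_bigr => k _.
    by rewrite rmorph1 !mul1r dxi rmorphM /= conjCK exprMn.
  apply: sumw0; under eq_bigr do rewrite -rmorphXn.
  by rewrite -rmorph_sum sumw // rmorph0.
transitivity (\sum_(j < 5) \sum_(k < 5) (w ^+ j) ^+ m * ((w ^+ k)^*) ^+ m).
  apply: eq_bigr => j _; apply: eq_bigr => k _.
  by rewrite rmorph1 !mul1r dxi exprMn.
by apply: sumw0; exact: sumw.
Qed.

End HarmonicPsi.

(** * Partial derivatives on the closed disc *)

Section Derivatives.
Variable R : realType.
Implicit Types (x y : R) (A B M : nat -> R) (f F : Cx R -> Cx R) (z w : Cx R).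

(** These points start at w and tend to z along a segment, which convexity keeps in the disc even
    when z is a boundary point. *)
Definition segment_seq z w (k : nat) : Cx R := z + ofR (harmonic k) * (w - z).

Lemma cvg_segment_seq z w : disc z -> disc w -> w != z ->
  segment_seq z w k @[k --> \oo] --> within (@disc R) z^'.
Proof.
move=> z1 w1 wz.
have segz : segment_seq z w k @[k --> \oo] --> z.
  have tc : ofR (harmonic k) @[k --> \oo] --> ofR (0 : R).
    by apply: cvg_ofR; exact: cvg_harmonic.
  have zE : z + ofR (0 : R) * (w - z) = z.
    by rewrite (_ : ofR 0 = 0) ?mul0r ?addr0 //; apply/eqP; rewrite ofR_eq0.
  rewrite -{2}zE; exact: (cvgD (cvg_cst z) (cvgM tc (cvg_cst (w - z)))).
move=> P /segz; rewrite !nbhs_filterE /fmap /=.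
apply: filterS => k; apply; rewrite /segment_seq.
  rewrite -subr_eq0 [z + _]addrC addrK mulf_neq0 ?subr_eq0 //.
  by rewrite ofR_eq0 gt_eqF // harmonic_gt0.
have t1 : harmonic k <= 1 :> R by rewrite invf_le1 ?ltr0n // ler1n.
move: (harmonic k) (@harmonic_ge0 R k) t1 => t t0 t1.
have -> : z + ofR t * (w - z) = ofR (1 - t) * z + ofR t * w.
  by rewrite ofRB; ring.
rewrite /disc /= in z1 w1 *; apply: le_trans (ler_normD _ _) _.
rewrite !normrM !norm_ofR (ger0_norm t0) (ger0_norm (_ : 0 <= 1 - t)) ?subr_ge0 //.
apply: (@le_trans _ _ (ofR (1 - t) + ofR t)).
  by apply: lerD; rewrite ler_piMr ?ofR_ge0 ?subr_ge0.
by rewrite -ofRD subrK.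
Qed.

Lemma disc0 : @disc R 0. Proof. by rewrite /disc /= normr0. Qed.
Lemma disci : @disc R 'i. Proof. by rewrite /disc /= normCi. Qed.

Lemma ReMofR x z : 'Re (ofR x * z) = ofR x * 'Re z.
Proof. by rewrite ReMl //; apply/complex_realP; exists x. Qed.
Lemma ImMofR x z : 'Im (ofR x * z) = ofR x * 'Im z.
Proof. by rewrite ImMl //; apply/complex_realP; exists x. Qed.

(** With t = [harmonic k], the increment is t (w - z), so [|w - z|] times the remainder quotient of
    [has_partials] is the remainder divided by t. *)
Lemma directional_derivative f z w d : disc z -> disc w -> has_partials f z d ->
  (f (segment_seq z w k) - f z) / ofR (harmonic k) @[k --> \oo]
    --> 'Re (w - z) * d.1 + 'Im (w - z) * d.2.
Proof.
move=> z1 w1 fd; have t0 k : ofR (harmonic k : R) != 0.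
  by rewrite ofR_eq0 gt_eqF // harmonic_gt0.
(* The segment is then constant and misses the punctured neighbourhood, but both sides are 0. *)
have [->|wz] := eqVneq w z.
  rewrite subrr !raddf0 !mul0r addr0.
  have -> : (fun k => (f (segment_seq z z k) - f z) / ofR (harmonic k)) = (fun=> 0).
    by apply/funext => k; rewrite /segment_seq subrr mulr0 addr0 subrr mul0r.
  exact: cvg_cst.
have nwz : `|w - z| != 0 by rewrite normr_eq0 subr_eq0.
set D := _ + _.
have := cvg_comp _ _ (cvg_segment_seq z1 w1 wz) fd.
move=> /(cvgM (cvg_cst `|w - z|)) /(cvgD (cvg_cst D)).
rewrite mulr0 addr0; apply: cvg_trans; apply: near_eq_cvg; apply: nearW => k.
have segE : segment_seq z w k - z = ofR (harmonic k) * (w - z).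
  by rewrite /segment_seq [z + _]addrC addrK.
transitivity (D + `|w - z| * ((f (segment_seq z w k) - f z
    - ('Re (segment_seq z w k - z) * d.1 + 'Im (segment_seq z w k - z) * d.2))
    / `|segment_seq z w k - z|)); first exact: erefl.
rewrite segE ReMofR ImMofR normrM norm_ofR (ger0_norm (harmonic_ge0 k)) /D.
move: (harmonic k) (t0 k) => t t0k; field.
by rewrite t0k nwz.
Qed.

(** The directions towards 0, 1 and i suffice: subtracting the equation at 0 from those at 1 and at
    i isolates the two components. *)
Lemma has_partials_unique f z d d' :
  disc z -> has_partials f z d -> has_partials f z d' -> d = d'.
Proof.
move=> z1 fd fd'.
have eq_dir w : disc w -> 'Re (w - z) * d.1 + 'Im (w - z) * d.2
    = 'Re (w - z) * d'.1 + 'Im (w - z) * d'.2.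
  move=> w1; apply: (cvg_unique (@norm_hausdorff _ _)
    (directional_derivative z1 w1 fd)); exact: directional_derivative.
have e0 := eq_dir _ disc0; have e1 := eq_dir _ (disc1 R); have ei := eq_dir _ disci.
rewrite !raddfB /= in e0 e1 ei.
rewrite !raddf0 /= !sub0r in e0.
have R1 : 'Re (1 : Cx R) = 1 by apply/Creal_ReP; exact: rpred1.
have I1 : 'Im (1 : Cx R) = 0 by apply/Creal_ImP; exact: rpred1.
rewrite R1 I1 in e1; rewrite Re_i Im_i in ei.
move: d d' {fd fd' eq_dir} e0 e1 ei => [a b] [a' b'] /= e0 e1 ei.
congr (_, _).
  transitivity ((1 - 'Re z) * a + (0 - 'Im z) * b - (- 'Re z * a + - 'Im z * b)).
    by ring.
  by rewrite e0 e1; ring.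
transitivity ((0 - 'Re z) * a + (1 - 'Im z) * b - (- 'Re z * a + - 'Im z * b)).
  by ring.
by rewrite e0 ei; ring.
Qed.

Lemma partialsE f z d : disc z -> has_partials f z d -> partials f z = d.
Proof.
move=> z1 fd; apply: (has_partials_unique z1) (fd).
by rewrite /partials; apply: xgetPex; exists d.
Qed.


Definition dcoef A m : R := m.+1%:R * A m.+1.

Lemma dcoef_ge0 A m : (forall m, 0 <= A m) -> 0 <= dcoef A m.
Proof. by move=> A0; rewrite mulr_ge0. Qed.

(* For 0 <= x < 1, (f 1 - f x) / (1 - x) is at least every partial sum of
   sum_m (A_m + B_m) (1 + x + ... + x^(m-1)); let x tend to 1. *)
Lemma dcoef_summable A B f d : (forall m, 0 <= A m) -> (forall m, 0 <= B m) ->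
  harmonic_sum A B f -> has_partials f 1 d ->
  cvg (series (fun m => dcoef A m + dcoef B m) @ \oo).
Proof.
move=> A0 B0 hf fd; have disc1 := disc1 R.
have := directional_derivative disc1 disc0 fd; set D := _ + _ => fD.
pose C m := A m + B m; have C0 m : 0 <= C m by rewrite addr_ge0.
pose x k : R := 1 - harmonic k.
have x0 k : 0 <= x k by rewrite subr_ge0 invf_le1 ?ltr0n // ler1n.
have x1 k : x k <= 1 by rewrite gerBl harmonic_ge0.
have segE k : segment_seq 1 0 k = ofR (x k).
  by rewrite /segment_seq sub0r mulrN1 -ofRB.
have fx (y : R) : 0 <= y -> y <= 1 ->
    series (fun m => ofR (C m * y ^+ m)) @ \oo --> f (ofR y).
  move=> y0 y1.
  have dy : disc (ofR y) by rewrite /disc /= norm_ofR ger0_norm // (le_ofR y 1).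
  have := hf _ dy; rewrite conj_ofR.
  by under eq_fun => m do rewrite -mulrDl -ofRD -ofRX -ofRM.
have t0 k : ofR (harmonic k : R) != 0.
  by rewrite ofR_eq0 gt_eqF // harmonic_gt0.
(* This is C_m (1 - x^m) / (1 - x) as a geometric sum: visibly nonnegative, and tending to m C_m as
   x tends to 1. *)
pose S k m : Cx R := ofR (C m * \sum_(i < m) x k ^+ i).
have S0 k m : 0 <= S k m.
  by rewrite ofR_ge0 mulr_ge0 // sumr_ge0 // => i _; rewrite exprn_ge0.
have cvgS k : series (S k) @ \oo -->
    - ((f (segment_seq 1 0 k) - f 1) / ofR (harmonic k)).
  rewrite -mulNr opprB segE.
  have cB : (fun n => (ofR (harmonic k))^-1 * (series (fun m => ofR (C m * 1 ^+ m)) n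
      - series (fun m => ofR (C m * x k ^+ m)) n)) @ \oo -->
      (ofR (harmonic k))^-1 * (f (ofR 1) - f (ofR (x k))).
    exact: (cvgM (cvg_cst _) (cvgB (fx 1 ler01 (lexx 1)) (fx _ (x0 k) (x1 k)))).
  rewrite [X in _ --> X]mulrC; apply: cvg_trans cB; apply: near_eq_cvg; apply: nearW => n.
  rewrite /series /= -sumrB mulr_sumr; apply: eq_bigr => m _.
  apply: (mulfI (t0 k)); rewrite mulVKf //.
  rewrite -ofRB expr1n -mulrBr -opprB subrX1 -ofRM; congr ofR.
  transitivity ((1 - x k) * (C m * \sum_(i < m) x k ^+ i)); first by ring.
  by rewrite [in LHS]/x subKr.
have SleD n : series (fun m => ofR (C m * m%:R)) n <= - D.
  rewrite -subr_ge0; apply: (@limit_ge0 _ _ \oo _ (fun k =>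
    - ((f (segment_seq 1 0 k) - f 1) / ofR (harmonic k)) - series (S k) n)).
    by apply: nearW => k; rewrite subr_ge0; exact: (series_le_limit n (S0 k) (cvgS k)).
  have xc : ofR (x k) @[k --> \oo] --> ofR (1 : R).
    apply: cvg_ofR; rewrite -[X in _ --> X]subr0.
    by apply: cvgB; [exact: cvg_cst|exact: cvg_harmonic].
  have Sc m : S k m @[k --> \oo] --> ofR (C m * m%:R).
    rewrite ofRM (funext (fun k => ofRM (C m) (\sum_(i < m) x k ^+ i))).
    apply: (cvgM (cvg_cst _)).
    rewrite (funext (fun k => ofR_sum _ _ (fun i : 'I_m => x k ^+ i))).
    have -> : ofR m%:R = \sum_(i < m) ofR (1 : R).
      by rewrite -ofR_sum sumr_const card_ord.
    apply: cvg_finite_sum => i.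
    rewrite -(expr1n R i) ofRX (funext (fun k => ofRX (x k) i)).
    exact: cvg_pow.
  have quotc : - ((f (segment_seq 1 0 k) - f 1) / ofR (harmonic k)) @[k --> \oo] --> - D.
    exact: (cvgN fD).
  have sumc : series (S k) n @[k --> \oo] --> series (fun m => ofR (C m * m%:R)) n.
    exact: (cvg_partial_sum (phi := fun m k => S k m) Sc).
  exact: (cvgB quotc sumc).
have [r Dr] : exists r, - D = ofR r.
  apply: realC; apply: ger0_real; apply: le_trans (SleD 0%N).
  by rewrite /series /= big_geq.
apply: nondecreasing_is_cvgn.
  by apply: nondecreasing_series => m _ _; rewrite addr_ge0 ?dcoef_ge0.
exists r => _ [n _ <-]; rewrite -le_ofR -Dr; apply: le_trans (SleD n.+1).
(* The term m = 0 of the sum of m C_m is zero, so n + 1 of its terms match n terms with [dcoef]. *)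
rewrite -series_ofR le_ofR /series /= big_nat_recl // mulr0 add0r.
by apply: ler_sum => m _; rewrite /dcoef -mulrDr mulrC.
Qed.

End Derivatives.

(** * Termwise differentiation *)

Section TermwiseDerivative.
Variable R : realType.
Implicit Types (x y : R) (A B M : nat -> R) (f g h : Cx R -> Cx R) (z w : Cx R).

(** The quotient of w^(m+1) - z^(m+1) by w - z, written without division so that it is continuous in
    w at z too. *)
Definition diff_quot z m w : Cx R := \sum_(i < m.+1) w ^+ (m - i) * z ^+ i.

Lemma diff_quotE z m w : w ^+ m.+1 - z ^+ m.+1 = (w - z) * diff_quot z m w.
Proof. by rewrite subrXX; congr (_ * _); apply: eq_bigr => i _; rewrite subSS. Qed.

Lemma diff_quot_diag z m : diff_quot z m z = m.+1%:R * z ^+ m.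
Proof.
rewrite /diff_quot (eq_bigr (fun=> z ^+ m)) => [|i _].
  by rewrite sumr_const card_ord mulr_natl.
by rewrite -exprD subnK // -ltnS.
Qed.

Lemma norm_diff_quot_le z m w : disc z -> disc w -> `|diff_quot z m w| <= m.+1%:R.
Proof.
move=> z1 w1; apply: le_trans (ler_norm_sum _ _ _) _.
have -> : m.+1%:R = \sum_(i < m.+1) (1 : Cx R) by rewrite sumr_const card_ord.
apply: ler_sum => i _; rewrite normrM !normrX.
by rewrite mulr_ile1 ?exprn_ge0 // exprn_ile1.
Qed.

Lemma cvg_diff_quot (G : set_system (Cx R)) {FG : Filter G} z m :
  w @[w --> G] --> z -> diff_quot z m w @[w --> G] --> diff_quot z m z.
Proof.
move=> idz; apply: cvg_finite_sum => i.
exact: (cvgM (cvg_pow idz) (cvg_cst _)).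
Qed.

Lemma norm_coef_le A (v : Cx R) m : 0 <= A m.+1 -> `|v| <= m.+1%:R ->
  `|ofR (A m.+1) * v| <= ofR (dcoef A m).
Proof.
move=> A0 v1; rewrite normrM norm_ofR (ger0_norm A0) /dcoef mulrC ofRM ofR_nat.
by rewrite ler_wpM2r ?ofR_ge0.
Qed.

(* [f w - f z = (w - z) G w + (w - z)^* H w] with [G], [H] sums of normally
   convergent series of functions of [w], hence continuous at [z]. *)
Lemma harmonic_has_partials A B f g h z :
  (forall m, 0 <= A m) -> (forall m, 0 <= B m) ->
  cvg (series (dcoef A) @ \oo) -> cvg (series (dcoef B) @ \oo) ->
  harmonic_sum A B f -> harmonic_sum (dcoef A) (fun=> 0) g ->
  harmonic_sum (fun=> 0) (dcoef B) h -> disc z ->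
  has_partials f z (g z + h z, 'i * (g z - h z)).
Proof.
move=> A0 B0 cA cB hf hg hh z1.
pose phi m w := ofR (A m.+1) * diff_quot z m w.
pose psi m w := ofR (B m.+1) * (diff_quot z m w)^*.
have phi_le m w : disc w -> `|phi m w| <= ofR (dcoef A m).
  by move=> w1; apply: norm_coef_le => //; exact: norm_diff_quot_le.
have psi_le m w : disc w -> `|psi m w| <= ofR (dcoef B m).
  by move=> w1; apply: norm_coef_le => //; rewrite norm_conjC; exact: norm_diff_quot_le.
(* Outside the disc the implication is vacuous and 0 serves as witness, so that choice yields a
   total function. *)
have /choice[G phiG] w : exists L : Cx R, disc w -> series (phi^~ w) @ \oo --> L.
  have [w1|nw1] := pselect (disc w); last by exists 0 => /nw1.
  by have [L cL] := normal_series_cvg (fun m => phi_le m w w1) cA; exists L.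
have /choice[H psiH] w : exists L : Cx R, disc w -> series (psi^~ w) @ \oo --> L.
  have [w1|nw1] := pselect (disc w); last by exists 0 => /nw1.
  by have [L cL] := normal_series_cvg (fun m => psi_le m w w1) cB; exists L.
have zero : ofR (0 : R) = 0 by apply/eqP; rewrite ofR_eq0.
have Gz : G z = g z.
  apply: (cvg_unique (@norm_hausdorff _ _) (phiG z z1)).
  rewrite (_ : phi^~ z = fun m => ofR (dcoef A m) * z ^+ m + ofR 0 * z^* ^+ m).
    exact: hg.
  apply/funext => m; rewrite zero mul0r addr0 /phi diff_quot_diag /dcoef.
  by rewrite ofRM ofR_nat; ring.
have Hz : H z = h z.
  apply: (cvg_unique (@norm_hausdorff _ _) (psiH z z1)).
  rewrite (_ : psi^~ z = fun m => ofR 0 * z ^+ m + ofR (dcoef B m) * z^* ^+ m).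
    exact: hh.
  apply/funext => m; rewrite zero mul0r add0r /psi diff_quot_diag /dcoef.
  by rewrite rmorphM rmorph_nat rmorphXn /= ofRM ofR_nat; ring.
have fE w : disc w -> f w - f z = (w - z) * G w + (w - z)^* * H w.
  move=> w1.
  pose u n := series (fun m => ofR (A m) * w ^+ m + ofR (B m) * w^* ^+ m) n
    - series (fun m => ofR (A m) * z ^+ m + ofR (B m) * z^* ^+ m) n.
  have uf : u @ \oo --> f w - f z by exact: (cvgB (hf w w1) (hf z z1)).
  (* The constant terms cancel in the difference, hence n + 1 terms of f against n terms of [G] and
     [H]. *)
  have uSf : (fun n => u n.+1) @ \oo --> f w - f z.
    by have := uf; rewrite -cvg_shiftS.
  apply: (cvg_unique (@norm_hausdorff _ _) uSf).
  rewrite (_ : (fun n => u n.+1) = fun n =>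
      (w - z) * series (phi^~ w) n + (w - z)^* * series (psi^~ w) n).
    exact: (cvgD (cvgM (cvg_cst _) (phiG w w1)) (cvgM (cvg_cst _) (psiH w w1))).
  apply/funext => n; rewrite /u.
  rewrite /series /= [X in X - _]big_nat_recl // [X in _ - X]big_nat_recl //.
  rewrite !expr0 opprD addrACA subrr add0r -sumrB !mulr_sumr -big_split /=.
  apply: eq_bigr => m _; rewrite /phi /psi [X in _ = X + _]mulrCA -diff_quotE.
  by rewrite [X in _ = _ + X]mulrCA -rmorphM -diff_quotE rmorphB !rmorphXn /=; ring.
have FD := within_filter (@disc R) (nbhs_filter z).
have idz : w @[w --> within (@disc R) (nbhs z)] --> z by exact: cvg_within.
have phic m : phi m w @[w --> within (@disc R) (nbhs z)] --> phi m z.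
  exact: (cvgM (cvg_cst _) (cvg_diff_quot idz)).
have psic m : psi m w @[w --> within (@disc R) (nbhs z)] --> psi m z.
  exact: (cvgM (cvg_cst _) (cvg_conj (cvg_diff_quot idz))).
have Gc := dominated_series_cvg phi_le cA phiG z1 phic.
have Hc := dominated_series_cvg psi_le cB psiH z1 psic.
apply/cvgrPdist_lt => e e0; have e2 : 0 < e / 2 by rewrite divr_gt0.
move/cvgrPdist_lt: Gc => /(_ _ e2) Gc; move/cvgrPdist_lt: Hc => /(_ _ e2) Hc.
have close : \forall w \near nbhs z, disc w ->
    `|G z - G w| < e / 2 /\ `|H z - H w| < e / 2.
  exact: (filterI Gc Hc).
apply: filterS close => w close wz w1; have [Gw Hw] := close w1.
have nwz : 0 < `|w - z| by rewrite normr_gt0 subr_eq0.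
(* Splitting w - z into real and imaginary parts, the linear part is (w - z) g z plus the conjugate
   of w - z times h z; only the increments of [G] and [H] remain. *)
have -> : f w - f z - ('Re (w - z) * (g z + h z) + 'Im (w - z) * ('i * (g z - h z)))
    = - ((w - z) * (G z - G w) + (w - z)^* * (H z - H w)).
  rewrite fE // Gz Hz.
  have -> : 'Re (w - z) * (g z + h z) + 'Im (w - z) * ('i * (g z - h z))
     = (w - z) * g z + (w - z)^* * h z.
    rewrite [in RHS](Crect (w - z)) conjC_rect ?Creal_Re ?Creal_Im //; ring.
  by ring.
rewrite sub0r mulNr opprK normrM normfV normr_id ltr_pdivrMr //.
apply: le_lt_trans (ler_normD _ _) _; rewrite !normrM norm_conjC -mulrDr mulrC.
rewrite ltr_pM2r // [e](_ : _ = e / 2 + e / 2); last by field.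
exact: ltrD.
Qed.

Lemma dcoef0 : dcoef (fun=> 0) = (fun=> 0) :> (nat -> R).
Proof. by apply/funext => m; rewrite /dcoef mulr0. Qed.

Lemma ex_harmonic_sum A B : (forall m, 0 <= A m) -> (forall m, 0 <= B m) ->
  cvg (series (fun m => A m + B m) @ \oo) -> exists g, harmonic_sum A B g.
Proof.
move=> A0 B0 cAB.
have /choice[g hg] z : exists L : Cx R, disc z ->
    series (fun m => ofR (A m) * z ^+ m + ofR (B m) * z^* ^+ m) @ \oo --> L.
  have [z1|nz1] := pselect (disc z); last by exists 0 => /nz1.
  have [L cL] := normal_series_cvg (fun m => norm_harmonic_term_le (A0 m) (B0 m) z1) cAB.
  by exists L.
by exists g.
Qed.

Lemma harmonic_sumD A B A' B' f g : harmonic_sum A B f -> harmonic_sum A' B' g ->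
  harmonic_sum (fun m => A m + A' m) (fun m => B m + B' m) (fun z => f z + g z).
Proof.
move=> hf hg z z1; rewrite [X in X @ \oo --> _](_ : _ = fun n =>
    series (fun m => ofR (A m) * z ^+ m + ofR (B m) * z^* ^+ m) n
    + series (fun m => ofR (A' m) * z ^+ m + ofR (B' m) * z^* ^+ m) n).
  exact: (cvgD (hf z z1) (hg z z1)).
apply/funext => n; rewrite /series /= -big_split; apply: eq_bigr => m _ /=.
by rewrite !ofRD; ring.
Qed.

Lemma eq_harmonic_sum A B f g : (forall z, disc z -> f z = g z) ->
  harmonic_sum A B g -> harmonic_sum A B f.
Proof. by move=> fg hg z z1; rewrite (fg z z1); exact: hg. Qed.

(** Summability obtained at the point 1 makes the sums g and h of the differentiated series exist,
    and the partials are (g + h, i (g - h)). As i^2 = -1, D_z and D_zbar extract g and h. *)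
Lemma harmonic_descente A B f : (forall m, 0 <= A m) -> (forall m, 0 <= B m) ->
  harmonic_sum A B f -> differentiable_disc f ->
  [/\ harmonic_sum (dcoef A) (fun=> 0) (Dz f),
      harmonic_sum (fun=> 0) (dcoef B) (Dzbar f)
    & harmonic_sum (dcoef A) (dcoef B) (Dx f)].
Proof.
move=> A0 B0 hf /(_ 1 (disc1 R)) [d fd].
have cAB := dcoef_summable A0 B0 hf fd.
have dA0 m : 0 <= dcoef A m by exact: dcoef_ge0.
have dB0 m : 0 <= dcoef B m by exact: dcoef_ge0.
have cA : cvg (series (dcoef A) @ \oo).
  by apply: series_le_cvg cAB => // m; rewrite ?addr_ge0 ?lerDl.
have cB : cvg (series (dcoef B) @ \oo).
  by apply: series_le_cvg cAB => // m; rewrite ?addr_ge0 ?lerDr.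
have [g hg] : exists g, harmonic_sum (dcoef A) (fun=> 0) g.
  by apply: ex_harmonic_sum => //; under eq_fun do rewrite addr0.
have [h hh] : exists h, harmonic_sum (fun=> 0) (dcoef B) h.
  by apply: ex_harmonic_sum => //; under eq_fun do rewrite add0r.
have fp z : disc z -> partials f z = (g z + h z, 'i * (g z - h z)).
  move=> z1; apply: (partialsE z1).
  exact: (harmonic_has_partials A0 B0 cA cB hf hg hh z1).
split.
- apply: eq_harmonic_sum hg => z z1; rewrite /Dz /Dx /Dy fp //= mulrA mulCii.
  by field.
- apply: eq_harmonic_sum hh => z z1; rewrite /Dzbar /Dx /Dy fp //= mulrA mulCii.
  by field.
have := harmonic_sumD hg hh; rewrite (_ : (fun m => dcoef A m + 0) = dcoef A); last first.
  by apply/funext => m; rewrite addr0.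
rewrite (_ : (fun m => 0 + dcoef B m) = dcoef B); last first.
  by apply/funext => m; rewrite add0r.
by apply: eq_harmonic_sum => z z1; rewrite /Dx fp.
Qed.

End TermwiseDerivative.

Unset Implicit Arguments.
Set Strict Implicit.

Theorem mainTheorem3 (R : realType) (q : nat) (hq : (2 <= q)%N) :
  (forall (a : nat -> nat -> R) (f : Cx R -> Cx R),
    cvg (series (fun m => a m 0%N) @ \oo) ->
    (forall m, 0 < a m 0%N) ->
    (forall z, disc z ->
      series (fun m => ofR (a m 0%N) * disc_poly (q%:R - 2) m 0 z) @ \oo
        --> f z) ->
    PsiPlus q f /\
    (differentiable_disc f ->
      [/\ PsiPlus q.+1 (Dz f), PsiPlus q.+1 (Dx f)
        & ~ PsiPlus q.+1 (Dzbar f)])) /\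
  (forall (a : nat -> nat -> R) (f : Cx R -> Cx R),
    cvg (series (fun n => a 0%N n) @ \oo) ->
    (forall n, 0 < a 0%N n) ->
    (forall z, disc z ->
      series (fun n => ofR (a 0%N n) * disc_poly (q%:R - 2) 0 n z) @ \oo
        --> f z) ->
    PsiPlus q f /\
    (differentiable_disc f ->
      [/\ PsiPlus q.+1 (Dzbar f), PsiPlus q.+1 (Dx f)
        & ~ PsiPlus q.+1 (Dz f)])) /\
  (forall (a : nat -> nat -> R) (f : Cx R -> Cx R),
    (forall n, 0 <= a 0%N n) ->
    (forall m, 0 <= a m 0%N) ->
    (forall n, 0 < a 0%N n <-> exists k, n = (5 * k + 4)%N) ->
    (forall m, 0 < a m 0%N <->
      [\/ m <> 0%N /\ exists k, m = (5 * k)%N,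
          exists k, m = (5 * k + 2)%N,
          exists k, m = (5 * k + 3)%N
        | exists k, m = (5 * k + 4)%N]) ->
    (forall z, disc z -> exists s t : Cx R,
      [/\ series (fun n => ofR (a 0%N n) * disc_poly (q%:R - 2) 0 n z) @ \oo
            --> s,
          series (fun m => ofR (a m 0%N) * disc_poly (q%:R - 2) m 0 z) @ \oo
            --> t
        & f z = s + t]) ->
    PsiPlus q f /\
    (differentiable_disc f ->
      [/\ ~ PsiPlus q.+1 (Dz f), ~ PsiPlus q.+1 (Dzbar f)
        & ~ PsiPlus q.+1 (Dx f)])).
Proof.
have zero : ofR (0 : R) = 0 by apply/eqP; rewrite ofR_eq0.
have powsum (a : nat -> nat -> R) (z s : Cx R) :
    series (fun m => ofR (a m 0%N) * disc_poly (q%:R - 2) m 0 z) @ \oo --> s ->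
    series (fun m => ofR (a m 0%N) * z ^+ m + ofR 0 * z^* ^+ m) @ \oo --> s.
  under eq_fun => m do rewrite disc_poly_m0.
  by under [in X in _ -> X]eq_fun => m do rewrite zero mul0r addr0.
have conjsum (a : nat -> nat -> R) (z s : Cx R) :
    series (fun n => ofR (a 0%N n) * disc_poly (q%:R - 2) 0 n z) @ \oo --> s ->
    series (fun n => ofR 0 * z ^+ n + ofR (a 0%N n) * z^* ^+ n) @ \oo --> s.
  under eq_fun => m do rewrite disc_poly_0n.
  by under [in X in _ -> X]eq_fun => m do rewrite zero mul0r add0r.
have zero_le (m : nat) : (0 : R) <= 0 by [].
split; [|split].
- move=> a f _ apos asum; have a0 m : 0 <= a m 0%N by exact: ltW.
  have hf : harmonic_sum (fun m => a m 0%N) (fun=> 0) f.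
    by move=> z z1; apply: powsum; exact: asum.
  have sepa : separating (fun m => a m 0%N) (fun=> 0).
    exact: separating_all.
  split; first exact: (harmonic_PsiPlus _ a0 zero_le sepa hf).
  move=> /(harmonic_descente a0 zero_le hf); rewrite dcoef0 => -[hz hzb hx].
  have d0 m : 0 < dcoef (a^~ 0%N) m by rewrite mulr_gt0 // ltr0n.
  have d0' m := ltW (d0 m).
  have sepd : separating (dcoef (a^~ 0%N)) (fun=> 0).
    exact: separating_all.
  split; [exact: (harmonic_PsiPlus _ d0' zero_le sepd hz)
         |exact: (harmonic_PsiPlus _ d0' zero_le sepd hx)|].
  (* Here all coefficients of D_zbar f are 0, in particular those at multiples of 5. *)
  by apply: (harmonic_not_PsiPlus hzb).
- move=> a f _ apos asum; have a0 n : 0 <= a 0%N n by exact: ltW.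
  have hf : harmonic_sum (fun=> 0) (a 0%N) f.
    by move=> z z1; apply: conjsum; exact: asum.
  have sepa : separating (fun=> 0) (a 0%N)
    by apply: separatingC; exact: separating_all.
  split; first exact: (harmonic_PsiPlus _ zero_le a0 sepa hf).
  move=> /(harmonic_descente zero_le a0 hf); rewrite dcoef0 => -[hz hzb hx].
  have d0 n : 0 < dcoef (a 0%N) n by rewrite mulr_gt0 // ltr0n.
  have d0' n := ltW (d0 n).
  have sepd : separating (fun=> 0) (dcoef (a 0%N))
    by apply: separatingC; exact: separating_all.
  split; [exact: (harmonic_PsiPlus _ zero_le d0' sepd hzb)
         |exact: (harmonic_PsiPlus _ zero_le d0' sepd hx)|].
  by apply: (harmonic_not_PsiPlus hz).
move=> a f b0 a0 bP aP fsum.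
have hf : harmonic_sum (fun m => a m 0%N) (a 0%N) f.
  move=> z z1; have [s [t [sb sa ->]]] := fsum z z1.
  rewrite addrC [X in X @ \oo --> _](_ : _ = fun n =>
    series (fun m => ofR (a m 0%N) * z ^+ m + ofR 0 * z^* ^+ m) n
    + series (fun m => ofR 0 * z ^+ m + ofR (a 0%N m) * z^* ^+ m) n).
    exact: (cvgD (powsum _ _ _ sa) (conjsum _ _ _ sb)).
  apply/funext => n; rewrite /series /= -big_split; apply: eq_bigr => m _ /=.
  by rewrite zero !mul0r addr0 add0r.
split.
  apply: (harmonic_PsiPlus _ a0 b0 _ hf); apply: separating_mod5 => [j r r5 r1|j].
    apply/aP; case: r r5 r1 => [|[|[|[|[|]]]]] // _ _.
    - by constructor 1; split; [lia|exists j.+1; lia].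
    - by constructor 2; exists j.+1.
    - by constructor 3; exists j.+1.
    - by constructor 4; exists j.+1.
  by apply/bP; exists j.
move=> /(harmonic_descente a0 b0 hf)[hz hzb hx].
(* If 5 divides m, then m + 1 has residue 1, which occurs neither among the exponents of z nor among
   those of its conjugate. *)
have da5 m : (5 %| m)%N -> dcoef (a^~ 0%N) m = 0.
  move=> m5; rewrite /dcoef; have [->|am] := eqVneq (a m.+1 0%N) 0; first by rewrite mulr0.
  have : 0 < a m.+1 0%N by rewrite lt_def am a0.
  by move=> /aP[[_ [k ?]]|[k ?]|[k ?]|[k ?]]; lia.
have db5 m : (5 %| m)%N -> dcoef (a 0%N) m = 0.
  move=> m5; rewrite /dcoef; have [->|bm] := eqVneq (a 0%N m.+1) 0; first by rewrite mulr0.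
  have : 0 < a 0%N m.+1 by rewrite lt_def bm b0.
  by move=> /bP[k ?]; lia.
split.
- by apply: (harmonic_not_PsiPlus hz) => m m5; rewrite da5.
- by apply: (harmonic_not_PsiPlus hzb) => m m5; rewrite db5.
by apply: (harmonic_not_PsiPlus hx) => m m5; rewrite da5 // db5.
Qed.
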